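(* Let $M$ be chosen from $\underline{M}(3,1,n)$ and let $\omega=\omega(n)\to\infty$ slowly. Then with high probability every dependency $\underline{x}$ of $M$ satisfies either (i) $|\underline{x}|\le\omega$ (small), or (ii) $|\underline{x}|=n/2+O(\sqrt{n\log n})$ (large).
   Context: $\underline{M}(3,1,n)$ is the following random $n\times n$ matrix over $GF(2)$: columns are generated independently; column $i$ has a unit entry in row $i$ and two further unit entries, whose rows are chosen either independently and uniformly from $[n]$ with entries added mod 2 (with-replacement model), or as a uniformly random 2-subset of $[n]\setminus\{i\}$ (without-replacement model); all other entries are $0$. A dependency is a nonzero vector $\underline{x}\in\{0,1\}^n$ with $\underline{x}M=0$ over $GF(2)$, and $|\underline{x}|=|\{j:x_j=1\}|$. ''With high probability'' means with probability $1-o(1)$ as $n\to\infty$. *)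

(* Defs.v *)
From HB Require Import structures.
From mathcomp Require Import all_boot all_order all_algebra.
From mathcomp Require Import all_classical all_reals all_analysis.
Set Implicit Arguments.
Unset Strict Implicit.
Unset Printing Implicit Defensive.
Import Order.TTheory GRing.Theory Num.Theory.
Import numFieldNormedType.Exports.
Local Open Scope ring_scope.

Variant sampling_model := WithReplacement | WithoutReplacement.

(* The two further unit entries of column i lie in the rows (w i).1, (w i).2;
   coinciding entries, including the diagonal one, add up mod 2. *)
Definition mx_with_repl (n : nat) (w : {ffun 'I_n -> 'I_n * 'I_n}) :
    'M['F_2]_n :=
  \matrix_(j, i) ((j == i)%:R + (j == (w i).1)%:R + (j == (w i).2)%:R).

(* The two further unit entries of column i lie in the rows of the set w i. *)
Definition mx_without_repl (n : nat) (w : {ffun 'I_n -> {set 'I_n}}) :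
    'M['F_2]_n :=
  \matrix_(j, i) ((j == i) || (j \in w i))%:R.

Definition pairs_avoiding_diag (n : nat) : {set {ffun 'I_n -> {set 'I_n}}} :=
  [set w : {ffun 'I_n -> {set 'I_n}} |
    [forall i, (#|w i| == 2%N) && (i \notin w i)]].

(* Uniform probability on a finite set A; equals 0 if A is empty. *)
Definition unif_prob (R : realType) (T : finType) (A : {set T}) (E : pred T) :
    R :=
  #|[set w in A | E w]|%:R / #|A|%:R.

(* Probability that the random matrix M(3,1,n) satisfies E. The uniform law on
   a product set makes the columns independent, each with its uniform law.
   Without replacement the sample space is empty when 0 < n < 3; this does not
   affect limits as n tends to infinity. *)
Definition prob_M31 (R : realType) (model : sampling_model) (n : nat)
    (E : pred 'M['F_2]_n) : R :=
  match model with
  | WithReplacement =>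
      unif_prob R [set: {ffun 'I_n -> 'I_n * 'I_n}]
        (fun w => E (mx_with_repl w))
  | WithoutReplacement =>
      unif_prob R (pairs_avoiding_diag n) (fun w => E (mx_without_repl w))
  end.

Definition dependency (n : nat) (M : 'M['F_2]_n) (x : 'rV['F_2]_n) : bool :=
  (x != 0) && (x *m M == 0).

Definition weight (n : nat) (x : 'rV['F_2]_n) : nat :=
  #|[set j | x 0 j == 1]|.

(* Main.v *)
(* First moment over supports. A k-set is the support of a dependency with
   probability a^k (1-a)^(n-k), where p = k/n and a = 2p(1-p) (with replacement;
   without replacement a bounded factor is lost), so the expected number of
   dependencies of weight k is the binomial probability P(Bin(n,a) = k). A
   Chernoff bound gives exp(-k(1-2p)^2/9). For k <= n/4 this decays
   geometrically in k, so weights above omega contribute o(1); for larger k with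
   |k - n/2| > 6 sqrt(n log n) it is at most n^-4. *)
Require Import Defs.
From HB Require Import structures.
From mathcomp Require Import all_boot all_order all_algebra.
From mathcomp Require Import all_classical all_reals all_analysis.
From mathcomp Require Import ring lra.
Import Order.TTheory GRing.Theory Num.Theory.
Import numFieldNormedType.Exports.
Set Implicit Arguments.
Unset Strict Implicit.
Unset Printing Implicit Defensive.
Local Open Scope ring_scope.

(** * Chernoff-type bound for binomial probabilities *)

(** With s = sqrt u, squaring s <= e^(s-1) gives u <= exp(u - 1 - (s-1)^2). Since (u-1)^2 = (s-1)^2
    (s+1)^2 and s <= 2, the quadratic gain is at least (u-1)^2 / 9. *)
Lemma le_expR_sub_sq (R : realType) (u : R) :
  0 <= u <= 4 -> u <= expR (u - 1 - (u - 1) ^+ 2 / 9).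
Proof.
move=> /andP[u0 u4]; set s := Num.sqrt u.
have s0 : 0 <= s by rewrite sqrtr_ge0.
have us : u = s ^+ 2 by rewrite sqr_sqrtr.
have s2 : s <= 2.
  by rewrite -(@ler_pXn2r _ 2) ?nnegrE// -us; apply: le_trans u4 _; lra.
have es : s <= expR (s - 1) by have := expR_ge1Dx (s - 1); lra.
have : s ^+ 2 <= expR (s - 1) ^+ 2 by rewrite ler_pXn2r ?nnegrE ?expR_ge0.
rewrite -expRM_natl -us => /le_trans; apply; rewrite ler_expR us.
have -> : (s ^+ 2 - 1) ^+ 2 = (s - 1) ^+ 2 * (s + 1) ^+ 2 by ring.
have : (s - 1) ^+ 2 * (s + 1) ^+ 2 <= (s - 1) ^+ 2 * 9.
  by apply: ler_wpM2l; [exact: sqr_ge0 | nra].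
by lra.
Qed.

Lemma binomial_term_le_exprD (R : realType) (x y : R) (n k : nat) :
  0 <= x -> 0 <= y -> (k <= n)%N ->
  'C(n, k)%:R * x ^+ k * y ^+ (n - k) <= (x + y) ^+ n.
Proof.
move=> x0 y0 kn; rewrite addrC GRing.exprDn.
have kn1 : (k < n.+1)%N by [].
rewrite (bigD1 (Ordinal kn1)) //= -[leLHS]addr0 lerD //.
  by rewrite -mulr_natl; lra.
by apply: sumr_ge0 => i _; rewrite mulrn_wge0 // mulr_ge0 ?exprn_ge0.
Qed.

(* With a = 2p(1-p) = pu, the factor u ^+ k is split off so that the remaining
   term C(n,k) p^k (1-a)^(n-k) is at most (1 - a + p)^n. *)
Lemma binomial_pmf_le_expR (R : realType) (n k : nat) (p := k%:R / n%:R : R) :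
  (0 < n)%N -> (k <= n)%N ->
  'C(n, k)%:R * (2 * p * (1 - p)) ^+ k * (p ^+ 2 + (1 - p) ^+ 2) ^+ (n - k)
  <= expR (- (k%:R * (1 - 2 * p) ^+ 2 / 9)).
Proof.
move=> n0 kn.
have n0R : 0 < n%:R :> R by rewrite ltr0n.
have p0 : 0 <= p by rewrite divr_ge0.
have p1 : p <= 1 by rewrite ler_pdivrMr // mul1r ler_nat.
pose u := 2 * (1 - p).
have u0 : 0 <= u by rewrite /u; lra.
set b := p ^+ 2 + _; have b0 : 0 <= b by rewrite addr_ge0 ?sqr_ge0.
have -> : 2 * p * (1 - p) = u * p by rewrite /u; ring.
rewrite exprMn mulrCA -[leLHS]mulrA.
have H1 : 'C(n, k)%:R * p ^+ k * b ^+ (n - k) <= expR (n%:R * (p + b - 1)).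
  apply: le_trans (binomial_term_le_exprD _ _ _) _ => //.
  rewrite expRM_natl; apply: lerXn2r; rewrite ?nnegrE ?expR_ge0 //.
    exact: addr_ge0.
  by have := expR_ge1Dx (p + b - 1); rewrite addrC subrK.
have H2 : u ^+ k <= expR (k%:R * (u - 1 - (u - 1) ^+ 2 / 9)).
  rewrite expRM_natl; apply: lerXn2r; rewrite ?nnegrE ?expR_ge0 //.
  by apply: le_expR_sub_sq; rewrite /u; lra.
apply: le_trans (ler_pM _ _ H2 H1) _.
- exact: exprn_ge0.
- by rewrite !mulr_ge0 ?exprn_ge0.
(* As p + b - 1 = -p (u - 1) and k = p n, the linear parts of the two exponents cancel; u - 1 = 1 -
   2p turns the quadratic part into the claimed exponent. *)
rewrite -expRD ler_expR.
have kE : k%:R = p * n%:R by rewrite /p divfK // gt_eqF.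
by rewrite kE /u /b le_eqVlt; apply/orP; left; apply/eqP; field.
Qed.

(** * Union bound on a product space *)

Lemma card_ffun_family (T : finType) (n : nat) (F : 'I_n -> {set T}) :
  #|[set w : {ffun 'I_n -> T} | [forall i, w i \in F i]]| = (\prod_i #|F i|)%N.
Proof.
rewrite -[RHS]big_enum -[RHS](big_map (fun i => #|F i|) xpredT id) -foldrE.
rewrite -(card_family (fun i => mem (F i))); apply: eq_card => w; rewrite inE.
by apply/forallP/familyP.
Qed.

Lemma leq_card_cover_sum (I T : finType) (P : pred I) (B : I -> {set T})
    (A : {set T}) :
  (forall w, w \in A -> exists2 i, P i & w \in B i) ->
  (#|A| <= \sum_(i | P i) #|B i|)%N.
Proof.
move=> AB; pose U := \big[@finset.setU T/finset.set0]_(i | P i) B i.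
apply: (@leq_trans #|U|).
  by apply/subset_leq_card/fintype.subsetP => w /AB[i Pi wB]; apply/finset.bigcupP; exists i.
rewrite /U; elim/big_rec2: _ => [|i X m _ IH]; first by rewrite cards0.
by apply: leq_trans (leq_card_setU _ _) _; rewrite leq_add2l.
Qed.

(** Every failing [w] has a certificate [S] confining each coordinate. The number of [w] confined by
    a fixed [S] factors over the coordinates, which is where independence of the columns enters. *)
Lemma unif_prob_first_moment (R : realType) (T : finType) (n : nat)
    (G : 'I_n -> {set T}) (F : {set 'I_n} -> 'I_n -> {set T})
    (P : pred {set 'I_n}) (E : pred {ffun 'I_n -> T}) :
  (forall i, (0 < #|G i|)%N) ->
  (forall w : {ffun 'I_n -> T}, ~~ E w -> (forall i, w i \in G i) ->
    exists2 S, P S & forall i, w i \in F S i) ->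
  1 - \sum_(S | P S) \prod_i (#|F S i|%:R / #|G i|%:R)
  <= unif_prob R [set w : {ffun 'I_n -> T} | [forall i, w i \in G i]] E.
Proof.
move=> G0 cover; rewrite /unif_prob.
set A := [set w : {ffun 'I_n -> T} | [forall i, w i \in G i]].
have cardA : #|A| = (\prod_i #|G i|)%N by exact: card_ffun_family.
have A0 : 0 < #|A|%:R :> R.
  by rewrite ltr0n cardA prodn_gt0.
rewrite ler_pdivlMr // mulrBl mul1r lerBlDr mulr_suml.
under eq_bigr => S _ do
  rewrite prodf_div -!natr_prod -cardA divfK ?gt_eqF // -card_ffun_family.
rewrite -natr_sum -natrD ler_nat -(cardsID (finset E) A) leq_add //.
  by rewrite subset_leq_card //; apply/fintype.subsetP => w; rewrite !inE.
apply: leq_card_cover_sum => w; rewrite !inE => /andP[nEw /forallP wG].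
have [S PS wF] := cover w nEw wG.
by exists S => //; rewrite inE; apply/forallP.
Qed.

Lemma big_set_card (R : comPzSemiRingType) (n : nat) (Q : pred nat) (f : nat -> R) :
  \sum_(S : {set 'I_n} | Q #|S|) f #|S| = \sum_(k < n.+1 | Q k) 'C(n, k)%:R * f k.
Proof.
have cardS (S : {set 'I_n}) : (#|S| < n.+1)%N.
  by rewrite ltnS -[leqRHS]card_ord max_card.
rewrite (partition_big (fun S => Ordinal (cardS S)) (fun k => Q k)) //=.
apply: eq_bigr => k Qk.
rewrite -[X in 'C(X, _)]card_ord -card_draws mulr_natl -sumr_const.
apply: eq_big => [S|S /andP[_ /eqP <-]//].
by rewrite inE -val_eqE /=; case: eqP => [->|]; rewrite ?Qk ?andbF.
Qed.

(** * Dependencies as parity conditions on single columns *)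

Lemma dependency_support (n : nat) (M : 'M['F_2]_n) (x : 'rV['F_2]_n) (i : 'I_n) :
  dependency M x -> \sum_(j in [set j | x 0 j == 1]) M j i = 0.
Proof.
move=> /andP[_ /eqP/rowP/(_ i)]; rewrite !mxE => xM0.
rewrite -[RHS]xM0 big_mkcond; apply: eq_bigr => j _; rewrite inE.
case: eqVneq => [->|x1]; first by rewrite mul1r.
suff -> : x 0 j = 0 by rewrite mul0r.
by apply/val_inj; case: (x 0 j) x1 => [[|[|]]].
Qed.

(** A column with replacement. A 2-subset avoiding i, written as a pair of distinct rows, gives the
    same form, so one parity criterion serves both models. *)
Definition three_rows (n : nat) (i : 'I_n) (t : 'I_n * 'I_n) (j : 'I_n) : 'F_2 :=
  (j == i)%:R + (j == t.1)%:R + (j == t.2)%:R.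

(** Each unit entry contributes its membership in [S] mod 2. Hence for i in [S] exactly one of the
    two further rows must lie in [S], and for i outside [S] both or neither. *)
Lemma sum_three_rows_eq0 (n : nat) (S : {set 'I_n}) (i : 'I_n) (t : 'I_n * 'I_n) :
  (\sum_(j in S) three_rows i t j == 0) = ~~ ((i \in S) (+) (t.1 \in S) (+) (t.2 \in S)).
Proof.
have sum_delta (y : 'I_n) : \sum_(j in S) (j == y)%:R = (y \in S)%:R :> 'F_2.
  case: (boolP (y \in S)) => yS.
    by rewrite (bigD1 y) //= eqxx big1 ?addr0 // => j /andP[_ /negPf->].
  by rewrite big1 // => j jS; case: eqP => // jy; rewrite -jy jS in yS.
rewrite /three_rows !big_split /= !sum_delta.
by do 3 case: (_ \in S); rewrite -val_eqE.
Qed.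

(* The factor 1 + 10/n leaves room for sampling without replacement; over all
   columns it costs at most (1 + 10/n)^n <= e^10. *)
Lemma prob_dependencies_ge (R : realType) (T : finType) (n : nat)
    (G : 'I_n -> {set T}) (col : 'I_n -> T -> 'I_n -> 'F_2)
    (M : {ffun 'I_n -> T} -> 'M['F_2]_n) (Q : pred nat)
    (ortho := fun (S : {set 'I_n}) i => [set t in G i | \sum_(j in S) col i t j == 0])
    (p := fun k : nat => k%:R / n%:R : R) :
  (0 < n)%N ->
  (forall i, (0 < #|G i|)%N) ->
  (forall w : {ffun 'I_n -> T}, (forall i, w i \in G i) ->
     forall i j, M w j i = col i (w i) j) ->
  (forall (S : {set 'I_n}) i, i \in S ->
     #|ortho S i|%:R / #|G i|%:R <= (1 + 10 / n%:R) * (2 * p #|S| * (1 - p #|S|))) ->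
  (forall (S : {set 'I_n}) i, i \notin S ->
     #|ortho S i|%:R / #|G i|%:R <= (1 + 10 / n%:R) * (p #|S| ^+ 2 + (1 - p #|S|) ^+ 2)) ->
  1 - expR 10 * \sum_(k < n.+1 | ~~ Q k) expR (- (k%:R * (1 - 2 * p k) ^+ 2 / 9))
  <= unif_prob R [set w : {ffun 'I_n -> T} | [forall i, w i \in G i]]
       (fun w => [forall x : 'rV['F_2]_n, dependency (M w) x ==> Q (weight x)]).
Proof.
move=> n0 G0 Mcol in_le out_le.
apply: le_trans (unif_prob_first_moment (F := ortho) (P := fun S => ~~ Q #|S|) _ G0 _).
  rewrite lerD2l lerN2 mulr_sumr.
  pose c : R := 1 + 10 / n%:R.
  have c0 : 0 <= c by rewrite addr_ge0 ?divr_ge0.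
  have cn : c ^+ n <= expR 10.
    have -> : 10 = n%:R * (10 / n%:R) :> R by rewrite mulrC divfK // pnatr_eq0 -lt0n.
    by rewrite expRM_natl; apply: lerXn2r; rewrite ?nnegrE ?expR_ge0 ?expR_ge1Dx.
  pose f k := (c * (2 * p k * (1 - p k))) ^+ k * (c * (p k ^+ 2 + (1 - p k) ^+ 2)) ^+ (n - k).
  apply: (@le_trans _ _ (\sum_(S : {set 'I_n} | ~~ Q #|S|) f #|S|)).
    (* The k columns indexed by [S] are bounded by [in_le], the other n - k by [out_le]. *)
    apply: ler_sum => S _; rewrite /f (bigID (mem S)) /=.
    have -> : (n - #|S|)%N = #|[pred i | i \notin S]|.
      by rewrite -[X in (X - _)%N]card_ord -(cardC (mem S)) addKn; apply: eq_card.
    rewrite -!prodr_const; apply: ler_pM; rewrite ?prodr_ge0 // => *; rewrite ?divr_ge0 //.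
      by apply: ler_prod => i iS; rewrite divr_ge0 //= in_le.
    by apply: ler_prod => i iS; rewrite divr_ge0 //= out_le.
  rewrite (big_set_card n (fun k => ~~ Q k) f); apply: ler_sum => -[k /= kn] _.
  have {}kn : (k <= n)%N by [].
  rewrite /f; set al := 2 * _ * _; set be := _ + _ ^+ 2.
  rewrite !(exprMn _ c) [X in _ * X]mulrACA -exprD subnKC // mulrCA.
  apply: ler_pM; rewrite ?exprn_ge0 //.
    have p01 : 0 <= p k <= 1.
      by rewrite /p divr_ge0 //= ler_pdivrMr ?ltr0n // mul1r ler_nat.
    by rewrite !mulr_ge0 ?exprn_ge0 ?addr_ge0 ?sqr_ge0 ?mulr_ge0 //; lra.
  by rewrite mulrA; apply: binomial_pmf_le_expR.
(* Covering condition: a failing outcome has a dependency of excluded weight, and its support is the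
   certificate. *)
move=> w /forallPn[x]; rewrite negb_imply => /andP[dx nQ] wG.
exists [set j | x 0 j == 1] => // i; rewrite inE wG /=.
rewrite (eq_bigr (fun j => M w j i)) ?dependency_support // => j _.
by rewrite Mcol.
Qed.

(** * Column probabilities in the two sampling models *)

Lemma natr_cardsC (R : pzRingType) (n : nat) (S : {set 'I_n}) :
  #|~: S|%:R = n%:R - #|S|%:R :> R.
Proof.
have /(congr1 (fun m => m%:R : R)) : (#|S| + #|~: S|)%N = n.
  by rewrite cardsC card_ord.
by rewrite natrD => <-; rewrite addrC addKr.
Qed.

Lemma prob_with_repl_ge (R : realType) (n : nat) (Q : pred nat) : (0 < n)%N ->
  1 - expR 10 * \sum_(k < n.+1 | ~~ Q k)
      expR (- (k%:R * (1 - 2 * (k%:R / n%:R)) ^+ 2 / 9))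
  <= prob_M31 R WithReplacement (fun M : 'M['F_2]_n =>
       [forall x : 'rV['F_2]_n, dependency M x ==> Q (weight x)]).
Proof.
move=> n0; pose G (i : 'I_n) := [set: 'I_n * 'I_n].
have cardG i : #|G i| = (n * n)%N by rewrite cardsT card_prod card_ord.
have n0R : n%:R != 0 :> R by rewrite pnatr_eq0 -lt0n.
have inv0 : 0 <= 10 / n%:R :> R by rewrite divr_ge0.
rewrite /prob_M31.
have -> : [set: {ffun 'I_n -> 'I_n * 'I_n}] =
    [set w : {ffun 'I_n -> 'I_n * 'I_n} | [forall i, w i \in G i]].
  by apply/setP => w; rewrite !inE; apply/esym/forallP => i; rewrite inE.
have cardSC := @natr_cardsC R n.
apply: (prob_dependencies_ge (G := G) (col := @three_rows n)) => //.
- by move=> i; rewrite cardG muln_gt0 n0.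
- by move=> w _ i j; rewrite mxE.
- move=> S i iS.
  have -> : [set t in G i | \sum_(j in S) three_rows i t j == 0] =
      finset.setX S (~: S) :|: finset.setX (~: S) S.
    apply/setP => -[y z]; rewrite !inE sum_three_rows_eq0 /= iS.
    by do 2 case: (_ \in S).
  apply: (@le_trans _ _ (2 * (#|S|%:R / n%:R) * (1 - #|S|%:R / n%:R))).
    rewrite cardG; apply: (@le_trans _ _ ((#|S| * #|~: S| + #|~: S| * #|S|)%:R / (n * n)%:R)).
      rewrite ler_wpM2r // ler_nat -!cardsX; exact: leq_card_setU.
    by rewrite natrD !natrM cardSC le_eqVlt; apply/orP; left; apply/eqP; field.
  rewrite -[leLHS]mul1r ler_wpM2r ?lerDl //.
  have -> : 1 - #|S|%:R / n%:R = #|~: S|%:R / n%:R :> R by rewrite cardSC; field.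
  by rewrite !mulr_ge0.
- move=> S i /negPf iS.
  have -> : [set t in G i | \sum_(j in S) three_rows i t j == 0] =
      finset.setX S S :|: finset.setX (~: S) (~: S).
    apply/setP => -[y z]; rewrite !inE sum_three_rows_eq0 /= iS.
    by do 2 case: (_ \in S).
  apply: (@le_trans _ _ ((#|S|%:R / n%:R) ^+ 2 + (1 - #|S|%:R / n%:R) ^+ 2)).
    rewrite cardG; apply: (@le_trans _ _ ((#|S| * #|S| + #|~: S| * #|~: S|)%:R / (n * n)%:R)).
      rewrite ler_wpM2r // ler_nat -!cardsX; exact: leq_card_setU.
    by rewrite natrD !natrM cardSC le_eqVlt; apply/orP; left; apply/eqP; field.
  by rewrite -[leLHS]mul1r ler_wpM2r ?lerDl // addr_ge0 ?sqr_ge0.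
Qed.

Lemma prob_without_repl_ge (R : realType) (n : nat) (Q : pred nat) : (3 < n)%N ->
  1 - expR 10 * \sum_(k < n.+1 | ~~ Q k)
      expR (- (k%:R * (1 - 2 * (k%:R / n%:R)) ^+ 2 / 9))
  <= prob_M31 R WithoutReplacement (fun M : 'M['F_2]_n =>
       [forall x : 'rV['F_2]_n, dependency M x ==> Q (weight x)]).
Proof.
move=> n3; have n0 : (0 < n)%N by apply: leq_trans n3.
pose G (i : 'I_n) := [set s : {set 'I_n} | (#|s| == 2%N) && (i \notin s)].
have cardG i : #|G i| = 'C(n.-1, 2).
  rewrite -[n in n.-1]card_ord -(cardsT 'I_n) (cardsD1 i [set: 'I_n]) inE /=.
  rewrite -cards_draws; apply: eq_card => s; rewrite !inE andbC; congr (_ && _).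
  by rewrite subsetD1 finset.subsetT.
have n3R : 4 <= n%:R :> R by rewrite ler_nat.
have inv0 : 0 <= 10 / n%:R :> R by rewrite divr_ge0.
have binR (m : nat) : 'C(m, 2)%:R = m%:R * (m%:R - 1) / 2 :> R.
  case: m => [|m]; first by rewrite bin0n !mul0r.
  apply: (@mulfI _ 2); first by rewrite pnatr_eq0.
  have := mul_bin_diag m.+1 1; rewrite bin1 /= => /(congr1 (fun k => k%:R : R)).
  by rewrite !natrM => <-; rewrite -natr1; field.
have cardGR i : #|G i|%:R = (n%:R - 1) * (n%:R - 2) / 2 :> R.
  by rewrite cardG binR -subn1 natrB //; congr (_ / _); ring.
have cardSC := @natr_cardsC R n.
(* Passing to 2-subsets avoiding i costs a factor n^2 / ((n-1)(n-2)). *)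
have ratio_le (a b : R) i : 0 <= a -> b <= a * n%:R ^+ 2 / 2 ->
    b / #|G i|%:R <= (1 + 10 / n%:R) * a.
  move=> a0 ba; rewrite cardGR ler_pdivrMr; last by nra.
  apply: le_trans ba _.
  have -> : (1 + 10 / n%:R) * a * ((n%:R - 1) * (n%:R - 2) / 2) =
      a * ((1 + 10 / n%:R) * ((n%:R - 1) * (n%:R - 2))) / 2 :> R by ring.
  rewrite ler_wpM2r ?invr_ge0 // ler_wpM2l //.
  (* The numerator 7n^2 - 28n + 20 is positive for n >= 4 but negative at n = 3, hence the
     hypothesis [3 < n]. *)
  have -> : (1 + 10 / n%:R) * ((n%:R - 1) * (n%:R - 2)) =
     n%:R ^+ 2 + (7 * n%:R ^+ 2 - 28 * n%:R + 20) / n%:R :> R by field; lra.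
  by rewrite lerDl divr_ge0 //; nra.
pose col (i : 'I_n) (s : {set 'I_n}) (j : 'I_n) : 'F_2 := ((j == i) || (j \in s))%:R.
(* The rows i, y, z are distinct, so the disjunction in [col] agrees with the sum mod 2. *)
have colE i s y z : s \in G i -> s = [set y; z] -> y != z ->
    col i s =1 three_rows i (y, z).
  rewrite inE => /andP[_ is_] sE yz j; move: is_.
  rewrite /col /three_rows sE !inE negb_or => /andP[iy iz].
  case: (eqVneq j i) => [->|_] /=; first by rewrite (negPf iy) (negPf iz) !addr0.
  by case: eqVneq => [->|_] /=; rewrite ?(negPf yz) ?addr0 ?add0r.
have orthoP (S : {set 'I_n}) i s : s \in [set t in G i | \sum_(j in S) col i t j == 0] ->
    exists y z, [/\ s = [set y; z], #|s| == 2%N & ~~ ((i \in S) (+) (y \in S) (+) (z \in S))].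
  rewrite inE => /andP[sG]; have := sG; rewrite inE => /andP[s2 _].
  have /cards2P[y [z [yz sE]]] := s2.
  rewrite (eq_bigr _ (fun j _ => colE i s y z sG sE yz j)) sum_three_rows_eq0.
  by move=> h; exists y, z.
rewrite /prob_M31; have -> : pairs_avoiding_diag n =
    [set w : {ffun 'I_n -> {set 'I_n}} | [forall i, w i \in G i]].
  by apply/setP => w; rewrite !inE; apply: eq_forallb => i; rewrite inE.
apply: (prob_dependencies_ge (G := G) (col := col)) => //.
- by move=> i; rewrite cardG bin_gt0; case: (n) n3 => [|[|[|[]]]].
- by move=> w _ i j; rewrite mxE.
- move=> S i iS; set F := [set t in G i | _].
  have p1 : 1 - #|S|%:R / n%:R = #|~: S|%:R / n%:R :> R by rewrite cardSC; field; lra.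
  apply: ratio_le; first by rewrite p1 !mulr_ge0.
  (* An orthogonal 2-subset has one point in [S] and one outside, so it is the image of a pair in
     the product of [S] and its complement. *)
  apply: (@le_trans _ _ (#|S| * #|~: S|)%:R).
    rewrite ler_nat -cardsX.
    apply: leq_trans (leq_imset_card (fun t => [set t.1; t.2]) _).
    apply/subset_leq_card/fintype.subsetP => s /orthoP[y [z [-> _]]]; rewrite iS.
    case yS: (y \in S); case zS: (z \in S) => // _.
      by apply/imsetP; exists (y, z); rewrite // !inE yS zS.
    by apply/imsetP; exists (z, y); rewrite 1?finset.setUC // !inE yS zS.
  by rewrite p1 natrM le_eqVlt; apply/orP; left; apply/eqP; field; lra.
- move=> S i /negPf iS; set F := [set t in G i | _].
  apply: ratio_le; first by rewrite addr_ge0 ?sqr_ge0.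
  (* Now the 2-subset lies inside [S] or inside its complement; forgetting that it avoids i only
     enlarges the count. *)
  apply: (@le_trans _ _ ('C(#|S|, 2) + 'C(#|~: S|, 2))%:R).
    rewrite ler_nat -!cards_draws; apply: leq_trans (leq_card_setU _ _).
    apply/subset_leq_card/fintype.subsetP => s /orthoP[y [z [-> s2]]]; rewrite iS.
    rewrite !inE !finset.subUset !finset.sub1set !inE s2.
    by case: (y \in S); case: (z \in S).
  rewrite natrD !binR cardSC.
  have : #|S|%:R <= n%:R :> R by rewrite ler_nat -[leqRHS]card_ord max_card.
  have -> : ((#|S|%:R / n%:R) ^+ 2 + (1 - #|S|%:R / n%:R) ^+ 2) * n%:R ^+ 2 / 2 =
     (#|S|%:R ^+ 2 + (n%:R - #|S|%:R) ^+ 2) / 2 :> R by field; lra.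
  have : 0 <= #|S|%:R :> R by [].
  by lra.
Qed.

(** * Summation over intermediate weights *)

Lemma sum_intermediate_weights_le (R : realType) (n : nat) (w : R) : (0 < n)%N ->
  \sum_(k < n.+1 | ~~ ((k%:R <= w) ||
                       (`|k%:R - n%:R / 2| <= 6 * Num.sqrt (n%:R * ln n%:R) :> R)))
     expR (- (k%:R * (1 - 2 * (k%:R / n%:R)) ^+ 2 / 9))
  <= expR (- (w / 72)) / (1 - expR (- 72^-1)) + 2 / n%:R.
Proof.
move=> n0; have n1R : 1 <= n%:R :> R by rewrite ler1n.
have n0R : 0 < n%:R :> R by rewrite ltr0n.
pose q : R := expR (- 72^-1).
have q0 : 0 < q by exact: expR_gt0.
have q1 : q < 1 by rewrite expR_lt1 oppr_lt0 invr_gt0.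
apply: (@le_trans _ _ (\sum_(k < n.+1) (expR (- (w / 72)) * q ^+ k + (n%:R : R) ^- 4))).
  rewrite big_mkcond; apply: ler_sum => -[k /= kn] _.
  have e0 : 0 <= expR (- (w / 72)) * q ^+ k by rewrite mulr_ge0 ?expR_ge0 ?exprn_ge0 // ltW.
  have e1 : 0 <= n%:R ^- 4 :> R by rewrite invr_ge0 exprn_ge0.
  case: ifP; last by rewrite addr_ge0.
  rewrite negb_or -!ltNge => /andP[wk far].
  have k0 : 0 <= k%:R :> R by [].
  pose p : R := k%:R / n%:R.
  have kE : k%:R = p * n%:R by rewrite /p divfK // gt_eqF.
  have p0 : 0 <= p by rewrite divr_ge0.
  case: (lerP p (1 / 4)) => [p_small|p_large].
    (* Here (1 - 2p)^2 >= 1/4, so the decay exponent is at least k/36. One half of it exceeds w/72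
       because k > w; the other half is the geometric factor [q ^+ k]. *)
    rewrite -[leLHS]addr0 lerD // /q -expRM_natl -expRD ler_expR -/p.
    have : 4^-1 <= (1 - 2 * p) ^+ 2 by nra.
    by move=> /(ler_wpM2l k0); lra.
  (* The decay exponent equals (4/9) p n (p - 1/2)^2. With p > 1/4 and n (p - 1/2)^2 >= 36 ln n it
     is at least 4 ln n; the 36 is the square of the constant 6. *)
  rewrite -[leLHS]add0r lerD //.
  have -> : n%:R ^- 4 = expR (- (4 * ln n%:R)) :> R.
    by rewrite expRN expRM_natl lnK ?posrE.
  rewrite ler_expR lerN2 -/p.
  have ln0 : 0 <= ln n%:R :> R by rewrite ln_ge0.
  have {far} : 36 * (n%:R * ln n%:R) <= (k%:R - n%:R / 2) ^+ 2 :> R.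
    have : (6 * Num.sqrt (n%:R * ln n%:R)) ^+ 2 <= `|k%:R - n%:R / 2| ^+ 2 :> R.
      by apply: lerXn2r (ltW far); rewrite nnegrE ?mulr_ge0 ?sqrtr_ge0.
    by rewrite exprMn sqr_sqrtr ?mulr_ge0 // real_normK ?num_real //; lra.
  have -> : (k%:R - n%:R / 2) ^+ 2 = n%:R * (n%:R * (p - 2^-1) ^+ 2) :> R.
    by rewrite kE; field.
  rewrite mulrCA ler_pM2l // => far.
  rewrite kE; have : p * (36 * ln n%:R) <= p * (n%:R * (p - 2^-1) ^+ 2) by rewrite ler_wpM2l.
  have : 1 / 4 * ln n%:R <= p * ln n%:R by rewrite ler_wpM2r // ltW.
  have -> : p * n%:R * (1 - 2 * p) ^+ 2 / 9 = 4 / 9 * (p * (n%:R * (p - 2^-1) ^+ 2)) by field.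
  by lra.
rewrite big_split /= -mulr_sumr lerD //.
  rewrite ler_wpM2l ?expR_ge0 // -[leRHS]div1r ler_pdivlMr ?subr_gt0 //.
  rewrite mulrC -opprB mulNr -subrX1 opprB gerBl; exact/exprn_ge0/ltW.
rewrite sumr_const card_ord -[leLHS]mulr_natl -(natr1 n).
(* There are n + 1 <= 2n terms, and n^-4 <= n^-2 suffices. *)
have -> : 2 / n%:R = (2 * n%:R) * n%:R ^- 2 :> R.
  by field; rewrite gt_eqF.
apply: ler_pM; rewrite ?addr_ge0 ?invr_ge0 ?exprn_ge0 //; first by lra.
by rewrite lef_pV2 ?posrE ?exprn_gt0 // ler_weXn2l.
Qed.

(** * Passage to the limit *)

Lemma unif_prob_le1 (R : realType) (T : finType) (A : {set T}) (E : pred T) :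
  unif_prob R A E <= 1.
Proof.
(* For empty [A] the quotient is 0, since the inverse of 0 is 0. *)
rewrite /unif_prob; have [->|A0] := posnP #|A|; first by rewrite invr0 mulr0.
rewrite ler_pdivrMr ?ltr0n // mul1r ler_nat subset_leq_card //.
by apply/fintype.subsetP => w; rewrite inE => /andP[].
Qed.

Local Open Scope classical_set_scope.

Theorem theorem2 (R : realType) (model : sampling_model) :
  exists2 C : R, 0 < C &
    forall omega : nat -> R, omega n @[n --> \oo] --> +oo ->
      prob_M31 R model (fun M : 'M['F_2]_n =>
        [forall x : 'rV['F_2]_n, dependency M x ==>
           (((weight x)%:R <= omega n)
            || (`|(weight x)%:R - n%:R / 2| <= C * Num.sqrt (n%:R * ln n%:R)))])
        @[n --> \oo] --> (1 : R).
Proof.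
exists 6 => // omega omegay.
have err0 : 1 - expR 10 * (expR (- (omega n / 72)) / (1 - expR (- 72^-1)) + 2 / n%:R)
    @[n --> \oo] --> (1 : R).
  have E0 : expR (- (omega n / 72)) @[n --> \oo] --> (0 : R).
    apply: (cvg_comp (fun n => omega n / 72) (fun x : R => expR (- x)) _ (@cvgr_expR R)).
    apply/cvgryPge => A.
    near=> n; rewrite ler_pdivlMr //; near: n.
    exact: cvgry_ge.
  have I0 : (2 / n%:R : R) @[n --> \oo] --> (0 : R).
    rewrite -[X in _ --> X](mulr0 2); apply: cvgM; first exact: cvg_cst.
    (* The harmonic sequence is 1/(n+1), hence the shift by one index. *)
    by rewrite -(cvg_shiftS (fun n => n%:R^-1 : R)); exact: cvg_harmonic.
  rewrite -[X in _ --> X]subr0; apply: cvgB; first exact: cvg_cst.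
  rewrite -[X in _ --> X](mulr0 (expR 10)); apply: cvgM; first exact: cvg_cst.
  rewrite -[X in _ --> X]addr0; apply: cvgD => //.
  by rewrite -[X in _ --> X](mul0r (1 - expR (- 72^-1))^-1); apply: cvgM => //; exact: cvg_cst.
apply: squeeze_cvgr err0 (@cvg_cst _ (1 : R) _ _ _).
near=> n; apply/andP; split; last by case: model; exact: unif_prob_le1.
(* This also excludes the n for which the sample space without replacement is empty. *)
have n3 : (3 < n)%N by near: n; exact: nbhs_infty_gt.
have n0 : (0 < n)%N by apply: leq_trans n3.
pose Q k := (k%:R <= omega n) || (`|k%:R - n%:R / 2| <= 6 * Num.sqrt (n%:R * ln n%:R) :> R).
apply: (@le_trans _ _ (1 - expR 10 * \sum_(k < n.+1 | ~~ Q k)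
      expR (- (k%:R * (1 - 2 * (k%:R / n%:R)) ^+ 2 / 9)))).
  by rewrite lerD2l lerN2 ler_wpM2l ?expR_ge0 ?sum_intermediate_weights_le.
case: model; first exact: (prob_with_repl_ge R Q).
exact: (prob_without_repl_ge R Q).
Unshelve. all: by end_near.
Qed.
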